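(* Let $\mathcal{M}$ be a Minsky machine satisfying the standing assumptions below. Let $m\ge11$, let $f$ be an $n$-ary operation on $A(\mathcal{M})$ preserving every relation of $\mathbb{A}(\mathcal{M})$ of arity at most $m-1$, let $g_1,\dots,g_n\in A(\mathcal{M})^m$, and suppose that the subuniverse $R$ of $A(\mathcal{M})^m$ generated by $\{g_1,\dots,g_n\}$ is computational and non-halting. If $f(g_1,\dots,g_n)=\alpha$ and $\times\in\mathrm{Content}(\alpha)$ (i.e. $\alpha(i)\in X$ for some coordinate $i$), then $\alpha\in R$.
   Context: Minsky machines. A Minsky machine $\mathcal{M}$ has states $\{0,1,\dots,N\}$ ($0$ is the halting state, $1$ the initial state), two registers $A,B$ holding values in $\mathbb{N}$, and a finite set of instructions of the forms $(i,R,j)$ and $(i,R,k,j)$ with $R\in\{A,B\}$. It acts on configurations $(s,\alpha,\beta)\in\{0,\dots,N\}\times\mathbb{N}\times\mathbb{N}$: $\mathcal{M}(i,\alpha,\beta)$ is $(j,\alpha+1,\beta)$ if $(i,A,j)\in\mathcal{M}$; $(j,\alpha,\beta+1)$ if $(i,B,j)\in\mathcal{M}$; $(j,\alpha-1,\beta)$ if $(i,A,k,j)\in\mathcal{M}$ and $\alpha\neq0$; $(j,\alpha,\beta-1)$ if $(i,B,k,j)\in\mathcal{M}$ and $\beta\ne 0$; $(k,\alpha,\beta)$ if $(i,A,k,j)\in\mathcal{M}$ and $\alpha=0$, or $(i,B,k,j)\in\mathcal{M}$ and $\beta=0$; and $(0,\alpha,\beta)$ if $i=0$. $\mathcal{M}$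 halts if $\mathcal{M}^n(1,0,0)$ has state $0$ for some $n$. Standing assumptions on $\mathcal{M}$: it returns both registers to $0$ before halting; it has exactly one instruction $(i,\dots)$ for each non-halting state $i$; the instruction for state $1$ has the form $(1,R,s)$; in the state graph (vertices the states, an edge $i\to j$ iff $\mathcal{M}(i,\alpha,\beta)=(j,\alpha',\beta')$ for some $\alpha,\beta,\alpha',\beta'$) every state is reachable from $1$ and $0$ is reachable from every state; and $\mathcal{M}$ halts with capacity $\kappa$ (it halts and $\alpha+\beta\le\kappa$ whenever $\mathcal{M}^n(1,0,0)=(i,\alpha,\beta)$). The algebra. $A(\mathcal{M})=\{\langle i,c\rangle: 0\le i\le N,\ c\in\{\bullet,\times,0,A,B\}\}$. Put $X=\{\langle i,\times\rangle\}$, $D=\{\langle i,\bullet\rangle\}$, $C=A(\mathcal{M})\setminus(X\cup D)$; $\mathrm{X}(\langle i,c\rangle)=\langle i,\times\rangle$, $\mathrm{State}(\langle i,c\rangle)=i$, $\mathrm{Content}(\langle i,c\rangle)=c$, and for a tuple $a$, $\mathrm{Content}(a)=\{\mathrm{Content}(a(i))\}$. Write ''$(i,R,\dots,j)\in\mathcal{M}$'' to mean $(i,R,j)\in\mathcal{M}$ or $(i,R,k,j)\in\mathcal{M}$ for some $k$. The operations (cases read in order, first applicable case applies): $\langle i,c\rangle\wedge\langle j,d\rangle$ is $\langle i,c\rangle$ if the two are equal, else $\langle\min(i,j),\times\rangle$. $M(x,y)$: $\langle j,R\rangle$ if $x=\langle i,\bullet\rangle, y=\langle i,0\rangle,(i,R,j)\in\mathcal{M}$;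 $\langle j,0\rangle$ if $x=\langle i,\bullet\rangle,y=\langle i,R\rangle,(i,R,k,j)\in\mathcal{M}$; $\langle j,\bullet\rangle$ if $x=\langle i,0\rangle,y=\langle i,\bullet\rangle,(i,R,j)\in\mathcal{M}$; $\langle j,\bullet\rangle$ if $x=\langle i,R\rangle,y=\langle i,\bullet\rangle,(i,R,k,j)\in\mathcal{M}$; $\langle j,c\rangle$ if $x=y=\langle i,c\rangle$, $c\ne\bullet$, $(i,R,\dots,j)\in\mathcal{M}$; $\langle j,\times\rangle$ if $\mathrm{State}(x)=\mathrm{State}(y)=i$ and $(i,R,\dots,j)\in\mathcal{M}$; otherwise $\mathrm{X}(y)$. $M'(x)$: $\langle k,c\rangle$ if $x=\langle i,c\rangle$, $(i,R,k,j)\in\mathcal{M}$, $c\neq R$; $\langle k,\times\rangle$ if $\mathrm{State}(x)=i$ and $(i,R,k,j)\in\mathcal{M}$; otherwise $\mathrm{X}(x)$. $I(x,y)$: $\langle1,\bullet\rangle$ if $x\in D$; $\langle 1,0\rangle$ if $y\in C$; otherwise $\langle1,\times\rangle$. $H(x)$: $\langle0,0\rangle$ if $x\in\{\langle0,0\rangle,\langle0,\bullet\rangle\}$, otherwise $\langle0,\times\rangle$. $N_0(x,y,z)$: $y$ if $x=\langle0,\bullet\rangle$ and $\mathrm{State}(y)=\mathrm{State}(z)$; $z$ if $x=\langle0,0\rangle$, $z\notin D$, $\mathrm{State}(y)=\mathrm{State}(z)$; otherwise $\mathrm{X}(y\wedge z)$. $S(x,y,z)$: $\langle1,0\rangle$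 if $x=\langle1,0\rangle$, $\mathrm{State}(y)=\mathrm{State}(z)=1$ and $(\mathrm{Content}(y),\mathrm{Content}(z))\in\{(\bullet,0),(0,\bullet),(0,0)\}$; otherwise $\langle1,\times\rangle$. $N_\bullet(u,x,y,z)$, where the first four cases require $\mathrm{State}(x)=\mathrm{State}(y)=\mathrm{State}(z)$: $x$ if $x=y\notin X$; $x$ if $u\in D$, $y\in X$; $y$ if $u\in D$, $x\in X$; $z$ if $u\in D$, $z\in\{x,y\}$; otherwise $\mathrm{X}(x\wedge y\wedge z)$. $P(u,v,x,y)$: $x$ if $\mathrm{State}(u)=\mathrm{State}(v)$, else $y$. $\mathbb{A}(\mathcal{M})=\langle A(\mathcal{M});\wedge,M,M',I,H,N_0,S,N_\bullet,P\rangle$; operations act coordinatewise on powers; relations are subuniverses of powers. Relation notions. $s\in A(\mathcal{M})^m$ is synchronized if $\mathrm{State}(s(i))$ is constant in $i$. $R$ is computational if all its elements are synchronized and each $r\in R$ has at most one coordinate in $D$. $R$ is halting if it contains some $r\in\{\langle0,0\rangle,\langle0,\bullet\rangle\}^m\setminus\{\langle0,0\rangle\}^m$, and non-halting otherwise. Standing assumption: the subalgebra of $\mathbb{A}(\mathcal{M})$ generated by $\{\langle1,\bullet\rangle,\langle1,0\rangle\}$ contains $\langle0,\bullet\rangle$. *)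

(* Defs.v *)
From HB Require Import structures.
From mathcomp Require Import all_boot.
From Stdlib Require Import Relation_Operators.

Set Implicit Arguments.
Unset Strict Implicit.
Unset Printing Implicit Defensive.

Inductive reg := RegA | RegB.

Definition bool_of_reg r := if r is RegA then true else false.
Definition reg_of_bool b := if b then RegA else RegB.
Lemma bool_of_regK : cancel bool_of_reg reg_of_bool. Proof. by case. Qed.
HB.instance Definition _ := Finite.copy reg (can_type bool_of_regK).

Definition state (N : nat) := 'I_N.+1.

Definition halt_st {N} : state N := ord0.
(* This is the state 1 only when [0 < N], see [wf_pos]. *)
Definition init_st {N} : state N := inord 1.

(* [Inc i R j] is the instruction (i,R,j); [Dec i R k j] is (i,R,k,j). *)
Definition instr (N : nat) : Type :=
  (state N * reg * state N) + (state N * reg * state N * state N).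
Notation Inc i R j := (inl (i, R, j)).
Notation Dec i R k j := (inr (i, R, k, j)).

Definition source {N} (t : instr N) : state N :=
  match t with Inc i _ _ => i | Dec i _ _ _ => i end.

Definition minsky (N : nat) := {set instr N}.

(* Under [wf_prog] this is the unique instruction of [M] for state [i], and
   [None] for the halting state.  So "(i,R,j) is in M" is
   [instr_at M i = Some (Inc i R j)], and similarly for (i,R,k,j). *)
Definition instr_at {N} (M : minsky N) (i : state N) : option (instr N) :=
  [pick t in M | source t == i].

Definition config (N : nat) : Type := state N * nat * nat.

(* The [None] case does not occur for [i] non-halting, by [wf_prog]. *)
Definition step {N} (M : minsky N) (s : config N) : config N :=
  let: (i, a, b) := s in
  if i == halt_st then s else
  match instr_at M i with
  | Some (Inc _ RegA j) => (j, a.+1, b)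
  | Some (Inc _ RegB j) => (j, a, b.+1)
  | Some (Dec _ RegA k j) => if a == 0 then (k, a, b) else (j, a.-1, b)
  | Some (Dec _ RegB k j) => if b == 0 then (k, a, b) else (j, a, b.-1)
  | None => s
  end.

Definition run {N} (M : minsky N) (t : nat) : config N :=
  iter t (step M) (init_st, 0, 0).

Definition halts {N} (M : minsky N) : Prop :=
  exists t a b, run M t = (halt_st, a, b).

Definition halts_with_capacity {N} (M : minsky N) (kappa : nat) : Prop :=
  halts M /\ forall t i a b, run M t = (i, a, b) -> a + b <= kappa.

Definition state_edge {N} (M : minsky N) (i j : state N) : Prop :=
  exists a b a' b', step M (i, a, b) = (j, a', b').

Definition reachable {N} (M : minsky N) : state N -> state N -> Prop :=
  clos_refl_trans (state N) (state_edge M).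

Record wf_machine {N} (M : minsky N) (kappa : nat) : Prop := WfMachine {
  wf_pos : 0 < N;
  (* One instruction per non-halting state, none for the halting state (on
     which the action of the machine is the identity). *)
  wf_prog : forall i : state N,
    #|[set t in M | source t == i]| = (if i == halt_st then 0 else 1);
  wf_init : exists R s, Inc init_st R s \in M;
  wf_zero : forall t a b, run M t = (halt_st, a, b) -> a = 0 /\ b = 0;
  wf_from_init : forall i, reachable M init_st i;
  wf_to_halt : forall i, reachable M i halt_st;
  wf_capacity : halts_with_capacity M kappa
}.

Record algebra (T : Type) := Algebra {
  op_meet : T -> T -> T;
  op_M : T -> T -> T;
  op_M' : T -> T;
  op_I : T -> T -> T;
  op_H : T -> T;
  op_N0 : T -> T -> T -> T;
  op_S : T -> T -> T -> T;
  op_Ndot : T -> T -> T -> T -> T;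
  op_P : T -> T -> T -> T -> T
}.

Definition power {T : Type} (o : algebra T) (k : nat) :
    algebra {ffun 'I_k -> T} := {|
  op_meet := fun x y : {ffun 'I_k -> T} =>
    [ffun i : 'I_k => op_meet o (x i) (y i)];
  op_M := fun x y : {ffun 'I_k -> T} =>
    [ffun i : 'I_k => op_M o (x i) (y i)];
  op_M' := fun x : {ffun 'I_k -> T} =>
    [ffun i : 'I_k => op_M' o (x i)];
  op_I := fun x y : {ffun 'I_k -> T} =>
    [ffun i : 'I_k => op_I o (x i) (y i)];
  op_H := fun x : {ffun 'I_k -> T} =>
    [ffun i : 'I_k => op_H o (x i)];
  op_N0 := fun x y z : {ffun 'I_k -> T} =>
    [ffun i : 'I_k => op_N0 o (x i) (y i) (z i)];
  op_S := fun x y z : {ffun 'I_k -> T} =>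
    [ffun i : 'I_k => op_S o (x i) (y i) (z i)];
  op_Ndot := fun u x y z : {ffun 'I_k -> T} =>
    [ffun i : 'I_k => op_Ndot o (u i) (x i) (y i) (z i)];
  op_P := fun u v x y : {ffun 'I_k -> T} =>
    [ffun i : 'I_k => op_P o (u i) (v i) (x i) (y i)]
|}.

(* The empty set is a subuniverse. *)
Definition subuniverse {T : finType} (o : algebra T) (S : {set T}) : bool :=
  [&& [forall x in S, forall y in S, op_meet o x y \in S],
      [forall x in S, forall y in S, op_M o x y \in S],
      [forall x in S, op_M' o x \in S],
      [forall x in S, forall y in S, op_I o x y \in S],
      [forall x in S, op_H o x \in S],
      [forall x in S, forall y in S, forall z in S, op_N0 o x y z \in S],
      [forall x in S, forall y in S, forall z in S, op_S o x y z \in S],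
      [forall u in S, forall x in S, forall y in S, forall z in S,
         op_Ndot o u x y z \in S] &
      [forall u in S, forall v in S, forall x in S, forall y in S,
         op_P o u v x y \in S]].

Definition Sg {T : finType} (o : algebra T) (G : {set T}) : {set T} :=
  \bigcap_(S : {set T} | subuniverse o S && (G \subset S)) S.

Definition coordinatewise {T : Type} {n k : nat} (f : {ffun 'I_n -> T} -> T)
    (g : 'I_n -> {ffun 'I_k -> T}) : {ffun 'I_k -> T} :=
  [ffun i => f [ffun t => g t i]].

Definition preserves {T : finType} {n k : nat} (f : {ffun 'I_n -> T} -> T)
    (S : {set {ffun 'I_k -> T}}) : Prop :=
  forall g : 'I_n -> {ffun 'I_k -> T},
    (forall t, g t \in S) -> coordinatewise f g \in S.

Inductive content := Dot | Cross | Zero | Reg of reg.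

Definition content_enc c : option (option (option reg)) :=
  match c with
  | Dot => None | Cross => Some None
  | Zero => Some (Some None) | Reg r => Some (Some (Some r))
  end.
Definition content_dec o : content :=
  match o with
  | None => Dot | Some None => Cross
  | Some (Some None) => Zero | Some (Some (Some r)) => Reg r
  end.
Lemma content_encK : cancel content_enc content_dec. Proof. by case. Qed.
HB.instance Definition _ := Finite.copy content (can_type content_encK).

(* The element <i,c> is the pair [(i, c)]. *)
Definition elt (N : nat) : Type := state N * content.

Section AM.
Variable N : nat.
Implicit Types u v x y z : elt N.

Definition State x : state N := x.1.
Definition Content x : content := x.2.
Definition crossed x : elt N := (State x, Cross).

Definition inX x := Content x == Cross.
Definition inD x := Content x == Dot.
Definition inC x := ~~ inX x && ~~ inD x.

Definition AM_meet x y : elt N :=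
  if x == y then x
  else (if State x <= State y then State x else State y, Cross).

Variable M : minsky N.

Definition AM_M x y : elt N :=
  let c := Content x in let d := Content y in
  if State x == State y then
    match instr_at M (State x) with
    | Some (Inc _ R j) =>
        if (c == Dot) && (d == Zero) then (j, Reg R)
        else if (c == Zero) && (d == Dot) then (j, Dot)
        else if (c == d) && (c != Dot) then (j, c)
        else (j, Cross)
    | Some (Dec _ R k j) =>
        if (c == Dot) && (d == Reg R) then (j, Zero)
        else if (c == Reg R) && (d == Dot) then (j, Dot)
        else if (c == d) && (c != Dot) then (j, c)
        else (j, Cross)
    | None => crossed y
    end
  else crossed y.

Definition AM_M' x : elt N :=
  match instr_at M (State x) with
  | Some (Dec _ R k j) => if Content x != Reg R then (k, Content x)
                          else (k, Cross)
  | _ => crossed x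
  end.

Definition AM_I x y : elt N :=
  if inD x then (init_st, Dot)
  else if inC y then (init_st, Zero)
  else (init_st, Cross).

Definition AM_H x : elt N :=
  if (x == (halt_st, Zero)) || (x == (halt_st, Dot)) then (halt_st, Zero)
  else (halt_st, Cross).

Definition AM_N0 x y z : elt N :=
  if (x == (halt_st, Dot)) && (State y == State z) then y
  else if [&& x == (halt_st, Zero), ~~ inD z & State y == State z] then z
  else crossed (AM_meet y z).

Definition AM_S x y z : elt N :=
  if [&& x == (init_st, Zero), State y == init_st, State z == init_st &
         (Content y, Content z) \in [:: (Dot, Zero); (Zero, Dot); (Zero, Zero)]]
  then (init_st, Zero) else (init_st, Cross).

Definition AM_Ndot u x y z : elt N :=
  let same := (State x == State y) && (State y == State z) in
  if [&& same, x == y & ~~ inX x] then x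
  else if [&& same, inD u & inX y] then x
  else if [&& same, inD u & inX x] then y
  else if [&& same, inD u & (z == x) || (z == y)] then z
  else crossed (AM_meet (AM_meet x y) z).

Definition AM_P u v x y : elt N := if State u == State v then x else y.

Definition AM : algebra (elt N) := {|
  op_meet := AM_meet; op_M := AM_M; op_M' := AM_M'; op_I := AM_I;
  op_H := AM_H; op_N0 := AM_N0; op_S := AM_S; op_Ndot := AM_Ndot;
  op_P := AM_P
|}.

End AM.

Definition synchronized {N k} (s : {ffun 'I_k -> elt N}) : Prop :=
  forall i j, State (s i) = State (s j).

Definition computational {N k} (R : {set {ffun 'I_k -> elt N}}) : Prop :=
  forall r, r \in R ->
    synchronized r /\ (forall i j, inD (r i) -> inD (r j) -> i = j).

Definition halting {N k} (R : {set {ffun 'I_k -> elt N}}) : Prop :=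
  exists2 r, r \in R &
    (forall i, r i = (halt_st, Zero) \/ r i = (halt_st, Dot)) /\
    ~ (forall i, r i = (halt_st, Zero)).

(* Main.v *)
Require Import Defs.
From mathcomp Require Import all_boot.
From mathcomp Require Import boolp.
From Stdlib Require Import Relation_Operators.

Set Implicit Arguments.
Unset Strict Implicit.
Unset Printing Implicit Defensive.

(** Let [rho i] be the row of i-th coordinates of the generators.  On any [m - 1]
   rows, [f] agrees with a term operation, so for each [i] some [p_i] in [R]
   agrees with [alpha] off [i].  Meets settle the case of two crosses in [alpha];
   let [i0] be the only cross and [b] := [p_i0], crossless.  A term with a dot at
   some [i <> i0] gives [alpha] through [N_dot].  Any element in C off [i0] and
   crossed at [i0] can be turned into <0,0> off [i0] and <0,x> at [i0], and [N_0]
   with it restores [alpha] from [b].  If [i0] carries a dot in some element and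
   [b] lies in C, the machine can be run at coordinate [i0] with zeros elsewhere,
   so [R] is halting.

   There remains the case where [R] has no dots and every term that is in C on
   all rows but [rho i0] is in C on [rho i0] too; one shows that [f (rho i0)] is
   then in C.  Without dots, all operations are strict, and the set of
   rows [s] with [f s] in C is closed under every contentwise binary [F] with
   [F Zero Zero = Zero] that creates no register content.  From the [rho i],
   [i <> i0], such [F] produce, for each generator [t0], rows which are a register
   content on the generators indistinguishable from [t0] off [i0] and Zero
   elsewhere; these force the row equal to [rho i0] on that class and Zero
   elsewhere, and the latter rows glue to [rho i0]. *)

(** * Values of the basic operations: resulting states, and when a result lies in C *)

Section Values.
Variables (N : nat) (M : minsky N).
Implicit Types (i j k : state N) (u v x y z : elt N).

Lemma elt_eq x y : State x = State y -> Content x = Content y -> x = y.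
Proof. by case: x y => [i c] [j d] /= -> ->. Qed.

Definition state_meet i j : state N := if i <= j then i else j.

Lemma State_meet x y : State (AM_meet x y) = state_meet (State x) (State y).
Proof. by rewrite /AM_meet /state_meet; case: eqP => //= ->; case: ifP. Qed.

Lemma AM_meetxx x : AM_meet x x = x.
Proof. by rewrite /AM_meet eqxx. Qed.

Lemma crossed_meet x y : crossed (AM_meet x y)
  = (state_meet (State x) (State y), Cross).
Proof. by rewrite -State_meet. Qed.

Lemma state_meetxx i : state_meet i i = i.
Proof. by rewrite /state_meet leqnn. Qed.

Lemma inC_meet x y : inC (AM_meet x y) -> x = y.
Proof. by rewrite /AM_meet; case: eqP. Qed.

Lemma meet_cross i x y : State x = i -> State y = i -> inX x || inX y ->
  AM_meet x y = (i, Cross).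
Proof.
rewrite /AM_meet /inX => sx sy; case: (x =P y) => [<-|_ _]; last first.
  by rewrite sx sy leqnn.
by rewrite orbb => /eqP cx; apply: elt_eq.
Qed.

(* The state reached by [M], whatever the content; junk if there is no
   instruction. *)
Definition next_state i : state N :=
  match instr_at M i with
  | Some (Inc _ _ j) => j
  | Some (Dec _ _ _ j) => j
  | None => i
  end.

(** Here and in the following [State_] lemmas, the state of a result depends only on the states of
    the arguments, whichever case of the operation applies. *)
Lemma State_M x y : State (AM_M M x y) =
  if State x == State y then next_state (State x) else State y.
Proof.
rewrite /AM_M /next_state; case: (State x =P State y) => //= E.
by case: (instr_at M _) => [[[[? R] j]|[[[? R] k] j]]|] //=;
  do ?[case: ifP => // _].
Qed.

Lemma State_M' x : State (AM_M' M x) =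
  if instr_at M (State x) is Some (Dec _ _ k _) then k else State x.
Proof.
by rewrite /AM_M'; case: (instr_at M _) => [[[[? R] j]|[[[? R] k] j]]|] //=;
  case: ifP.
Qed.

Lemma State_I x y : State (AM_I x y) = init_st.
Proof. by rewrite /AM_I; do ?case: ifP => _. Qed.

Lemma State_H x : State (AM_H x) = halt_st.
Proof. by rewrite /AM_H; case: ifP. Qed.

Lemma State_N0 x y z : State (AM_N0 x y z) =
  state_meet (State y) (State z).
Proof.
rewrite /AM_N0 crossed_meet; case: (State y =P State z) => [E|_].
  by rewrite E state_meetxx; do ?case: ifP => _.
by rewrite !andbF.
Qed.

Lemma State_S x y z : State (AM_S x y z) = init_st.
Proof. by rewrite /AM_S; case: ifP. Qed.

Lemma State_Ndot u x y z : State (AM_Ndot u x y z) =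
  state_meet (state_meet (State x) (State y)) (State z).
Proof.
rewrite /AM_Ndot crossed_meet State_meet.
case: (State x =P State y) => [E|//]; case: (State y =P State z) => [E'|//].
by rewrite E E' !state_meetxx; do ?case: ifP => _; rewrite // E.
Qed.

Lemma State_P u v x y : State (AM_P u v x y) =
  if State u == State v then State x else State y.
Proof. by rewrite /AM_P; case: ifP. Qed.

(** [inC x] is convertible to [isC (Content x)], so invariants can be stated on contents alone. *)
Definition isC (c : content) := (c != Cross) && (c != Dot).

(** Both register branches of [AM_M] need a dot in one argument; without dots only the diagonal
    branch can land in C. *)
Lemma AM_M_noD x y : ~~ inD x -> ~~ inD y -> inC (AM_M M x y) ->
  [/\ x = y, inC x, instr_at M (State x) <> None
    & AM_M M x y = (next_state (State x), Content x)].
Proof.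
case: x y => [i c] [j d]; rewrite /AM_M /next_state /inC /inX /inD /=.
case: (i =P j) => // <- /negPf nDc /negPf nDd.
rewrite nDc nDd; case: (instr_at M i) => [[[[? R] j']|[[[? R] k] j']]|] //=;
rewrite andbF; case: (c =P d) => //= <-; rewrite nDc /= andbT => ->; by split.
Qed.

Lemma AM_M_inD x y : ~~ inD x -> ~~ inD y -> ~~ inD (AM_M M x y).
Proof.
case: x y => [i c] [j d]; rewrite /AM_M /inD /=.
case: (i =P j) => // _ nDc nDd; rewrite (negPf nDc) (negPf nDd) andbF /= andbT.
by case: (instr_at M i) => [[[[? R] j']|[[[? R] k] j']]|] //=;
  rewrite ?andbF; case: (c == d).
Qed.

Lemma AM_Mxx x : ~~ inD x -> instr_at M (State x) <> None ->
  AM_M M x x = (next_state (State x), Content x).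
Proof.
case: x => [i c]; rewrite /inD /AM_M /next_state /= eqxx => /negPf nD.
rewrite nD eqxx /=.
by case: (instr_at M i) => [[[[? R] j']|[[[? R] k] j']]|] //=; rewrite andbF.
Qed.

Lemma AM_M'_inC x : inC (AM_M' M x) -> inC x /\
  exists i R k j, [/\ instr_at M (State x) = Some (Dec i R k j),
    Content x <> Reg R & AM_M' M x = (k, Content x)].
Proof.
case: x => [i c]; rewrite /AM_M' /inC /inX /inD /=.
case: (instr_at M i) => [[[[? R] j']|[[[i' R] k] j']]|] //=.
by case: (c =P Reg R) => //= nR ->; split=> //; exists i', R, k, j'.
Qed.

Lemma AM_M_nX x y : ~~ inX (AM_M M x y) ->
  [/\ ~~ inX x, ~~ inX y, State x = State y & instr_at M (State x) <> None].
Proof.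
case: x y => [i c] [j d]; rewrite /AM_M /inX /=; case: (i =P j) => // <-.
case: (instr_at M i) => [[[[? R] j']|[[[? R] k] j']]|] //=;
by case: c => [|||?] //; case: d => [|||?] //; do ?[case: ifP => //];
  rewrite andbF.
Qed.

Lemma AM_M'_nX x : ~~ inX (AM_M' M x) -> ~~ inX x /\
  exists i R k j, instr_at M (State x) = Some (Dec i R k j) /\
    State (AM_M' M x) = k.
Proof.
case: x => [i c]; rewrite /AM_M' /inX /=.
case: (instr_at M i) => [[[[? R] j']|[[[i' R] k] j']]|] //=.
by case: (c =P Reg R) => //= _ ->; split=> //; exists i', R, k, j'.
Qed.

Lemma AM_M'E x i R k j : instr_at M (State x) = Some (Dec i R k j) ->
  Content x <> Reg R -> AM_M' M x = (k, Content x).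
Proof. by rewrite /AM_M' => -> /eqP->. Qed.

Lemma AM_I_inC x y : ~~ inD x -> inC (AM_I x y) -> inC y.
Proof. by rewrite /AM_I => /negPf->; case: ifP. Qed.

Lemma AM_IE x y : ~~ inD x -> inC y -> AM_I x y = (init_st, Zero).
Proof. by rewrite /AM_I => /negPf-> ->. Qed.

Lemma AM_I_cross x y : ~~ inD x -> ~~ inC y -> AM_I x y = (init_st, Cross).
Proof. by rewrite /AM_I => /negPf-> /negPf->. Qed.

Lemma AM_H_zero : AM_H (halt_st, Zero) = (halt_st, Zero) :> elt N.
Proof. by rewrite /AM_H eqxx. Qed.

Lemma AM_H_inC x : ~~ inD x -> inC (AM_H x) -> x = (halt_st, Zero).
Proof.
move=> nD; rewrite /AM_H; case: eqP => //= _; case: eqP => //= E.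
by rewrite E in nD.
Qed.

Lemma AM_N0_inC x y z : ~~ inD x -> inC (AM_N0 x y z) ->
  [/\ x = (halt_st, Zero), State y = State z & inC z].
Proof.
move=> nD; rewrite /AM_N0; case: eqP => /= [E|_]; first by rewrite E in nD.
by case: ifP => // /and3P[/eqP-> _ /eqP->].
Qed.

Lemma AM_N0E y z : State y = State z -> inC z ->
  AM_N0 (halt_st, Zero) y z = z.
Proof. by rewrite /AM_N0 /inC => -> /andP[_ ->]; rewrite !eqxx andbT; case: eqP. Qed.

(** Together with [AM_N0E], this makes the first argument of [AM_N0] a gate: Zero lets a value in C
    through, Cross crosses it. *)
Lemma AM_N0_cross y : AM_N0 (halt_st, Cross) y y = crossed y.
Proof. by rewrite /AM_N0; do ![case: eqP => //= _]; rewrite AM_meetxx. Qed.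

Lemma AM_S_inC x y z : ~~ inD y -> ~~ inD z -> inC (AM_S x y z) ->
  [/\ x = (init_st, Zero), y = (init_st, Zero) & z = (init_st, Zero)].
Proof.
case: y z => [j d] [k e]; rewrite /inD /AM_S /= => nd ne.
case: ifP => // /and4P[/eqP-> /eqP-> /eqP->]; rewrite !inE.
by case/or3P => /eqP[E1 E2]; move: nd ne; rewrite E1 E2.
Qed.

Lemma AM_Ndot_inC u x y z : ~~ inD u -> inC (AM_Ndot u x y z) ->
  [/\ x = y, inC x & State y = State z].
Proof.
rewrite /AM_Ndot => /negPf->; rewrite !andbF /=.
by case: ifP => // /and3P[/andP[_ /eqP->] /eqP->].
Qed.

Lemma AM_NdotE u x z : ~~ inX x -> State x = State z -> AM_Ndot u x x z = x.
Proof. by rewrite /AM_Ndot !eqxx => -> ->; rewrite eqxx. Qed.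

Lemma AM_Ndot_cross i u x y z : ~~ inD u -> inX x ->
  State x = i -> State y = i -> State z = i -> AM_Ndot u x y z = (i, Cross).
Proof.
rewrite /AM_Ndot => /negPf-> -> sx sy sz.
by rewrite !andbF /= crossed_meet State_meet sx sy sz !state_meetxx.
Qed.

Lemma AM_Ndot_select u x z : inD u -> State x = State z -> ~~ inX z ->
  AM_Ndot u x z z = z.
Proof.
rewrite /AM_Ndot => -> -> /negPf-> /=; rewrite !eqxx /= orbT.
by case: ifP => [/andP[/eqP]|_] //; case: ifP.
Qed.

End Values.

(** * Subuniverses and generation *)

Section Subuniverses.
Variables (T : finType) (o : algebra T) (S : {set T}).

Lemma subuniverseP :
  [/\ (forall x y, x \in S -> y \in S -> op_meet o x y \in S)
      /\ (forall x y, x \in S -> y \in S -> op_M o x y \in S),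
      (forall x, x \in S -> op_M' o x \in S)
      /\ (forall x y, x \in S -> y \in S -> op_I o x y \in S),
      (forall x, x \in S -> op_H o x \in S)
      /\ (forall x y z, x \in S -> y \in S -> z \in S -> op_N0 o x y z \in S),
      (forall x y z, x \in S -> y \in S -> z \in S -> op_S o x y z \in S) &
      (forall u x y z, u \in S -> x \in S -> y \in S -> z \in S ->
         op_Ndot o u x y z \in S)
      /\ (forall u v x y, u \in S -> v \in S -> x \in S -> y \in S ->
         op_P o u v x y \in S)] <-> subuniverse o S.
Proof.
split=> [[[h1 h2] [h3 h4] [h5 h6] h7 [h8 h9]]|].
  do ![apply/andP; split];
    do ![apply/forall_inP => ? ?]; by [apply: h1|apply: h2|apply: h3|apply: h4
    |apply: h5|apply: h6|apply: h7|apply: h8|apply: h9].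
case/andP => h1 /andP[h2 /andP[h3 /andP[h4 /andP[h5 /andP[h6 /andP[h7 /andP[h8 h9]]]]]]].
split; [split|split|split| |split].
- by move=> x y Sx Sy; move/forall_inP: h1 => /(_ x Sx) /forall_inP ->.
- by move=> x y Sx Sy; move/forall_inP: h2 => /(_ x Sx) /forall_inP ->.
- by move=> x Sx; move/forall_inP: h3 => ->.
- by move=> x y Sx Sy; move/forall_inP: h4 => /(_ x Sx) /forall_inP ->.
- by move=> x Sx; move/forall_inP: h5 => ->.
- by move=> x y z Sx Sy Sz; move/forall_inP: h6
    => /(_ x Sx) /forall_inP /(_ y Sy) /forall_inP ->.
- by move=> x y z Sx Sy Sz; move/forall_inP: h7
    => /(_ x Sx) /forall_inP /(_ y Sy) /forall_inP ->.
- by move=> u x y z Su Sx Sy Sz; move/forall_inP: h8 => /(_ u Su) /forall_inP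
    /(_ x Sx) /forall_inP /(_ y Sy) /forall_inP ->.
- by move=> u x y z Su Sx Sy Sz; move/forall_inP: h9 => /(_ u Su) /forall_inP
    /(_ x Sx) /forall_inP /(_ y Sy) /forall_inP ->.
Qed.

Lemma Sg_min (G : {set T}) x :
  subuniverse o S -> G \subset S -> x \in Sg o G -> x \in S.
Proof. by move=> oS GS /bigcapP; apply; rewrite oS. Qed.

End Subuniverses.

Lemma mem_Sg (T : finType) (o : algebra T) (G : {set T}) x :
  x \in G -> x \in Sg o G.
Proof. by move=> Gx; apply/bigcapP => S /andP[_ /subsetP]; apply. Qed.

Lemma Sg_subuniverse (T : finType) (o : algebra T) (G : {set T}) :
  subuniverse o (Sg o G).
Proof.
have sub S : subuniverse o S && (G \subset S) -> forall x, x \in Sg o G -> x \in S.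
  by case/andP => oS GS x; apply: Sg_min.
apply/subuniverseP; do ![split]; move=> *; apply/bigcapP => S GS;
  have /andP[/subuniverseP[[h1 h2] [h3 h4] [h5 h6] h7 [h8 h9]] _] := GS;
  by [apply: h1; exact: sub GS _ _|apply: h2; exact: sub GS _ _
     |apply: h3; exact: sub GS _ _|apply: h4; exact: sub GS _ _
     |apply: h5; exact: sub GS _ _|apply: h6; exact: sub GS _ _
     |apply: h7; exact: sub GS _ _|apply: h8; exact: sub GS _ _
     |apply: h9; exact: sub GS _ _].
Qed.

(** * Term operations and interpolation of [f] by them *)

Section TermOperations.
Variables (N : nat) (M : minsky N) (n : nat).
Local Notation row := {ffun 'I_n -> elt N}.
Implicit Types (p q r u v : row -> elt N) (s : row).

(** Terms are taken as functions, not as syntax, so they are evaluated on any row by plain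
    application. *)
Inductive term_op : (row -> elt N) -> Prop :=
| term_proj t : term_op (fun s => s t)
| term_meet p q : term_op p -> term_op q ->
    term_op (fun s => AM_meet (p s) (q s))
| term_M p q : term_op p -> term_op q -> term_op (fun s => AM_M M (p s) (q s))
| term_M' p : term_op p -> term_op (fun s => AM_M' M (p s))
| term_I p q : term_op p -> term_op q -> term_op (fun s => AM_I (p s) (q s))
| term_H p : term_op p -> term_op (fun s => AM_H (p s))
| term_N0 p q r : term_op p -> term_op q -> term_op r ->
    term_op (fun s => AM_N0 (p s) (q s) (r s))
| term_S p q r : term_op p -> term_op q -> term_op r ->
    term_op (fun s => AM_S (p s) (q s) (r s))
| term_Ndot u p q r : term_op u -> term_op p -> term_op q -> term_op r ->
    term_op (fun s => AM_Ndot (u s) (p s) (q s) (r s))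
| term_P u v p q : term_op u -> term_op v -> term_op p -> term_op q ->
    term_op (fun s => AM_P (u s) (v s) (p s) (q s)).

Lemma term_op_subuniverse k (S : {set {ffun 'I_k -> elt N}})
    (g : 'I_n -> {ffun 'I_k -> elt N}) p :
  subuniverse (power (AM M) k) S -> (forall t, g t \in S) -> term_op p ->
  coordinatewise p g \in S.
Proof.
move=> /subuniverseP[[h1 h2] [h3 h4] [h5 h6] h7 [h8 h9]] Sg.
elim=> [t|{}p q _ hp _ hq|{}p q _ hp _ hq|{}p _ hp|{}p q _ hp _ hq|{}p _ hp
  |{}p q r _ hp _ hq _ hr|{}p q r _ hp _ hq _ hr
  |u {}p q r _ hu _ hp _ hq _ hr|u v {}p q _ hu _ hv _ hp _ hq].
- by rewrite (_ : coordinatewise _ g = g t) //; apply/ffunP => i; rewrite !ffunE.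
- by move: (h1 _ _ hp hq); congr (_ \in S); apply/ffunP => i; rewrite !ffunE.
- by move: (h2 _ _ hp hq); congr (_ \in S); apply/ffunP => i; rewrite !ffunE.
- by move: (h3 _ hp); congr (_ \in S); apply/ffunP => i; rewrite !ffunE.
- by move: (h4 _ _ hp hq); congr (_ \in S); apply/ffunP => i; rewrite !ffunE.
- by move: (h5 _ hp); congr (_ \in S); apply/ffunP => i; rewrite !ffunE.
- by move: (h6 _ _ _ hp hq hr); congr (_ \in S); apply/ffunP => i; rewrite !ffunE.
- by move: (h7 _ _ _ hp hq hr); congr (_ \in S); apply/ffunP => i; rewrite !ffunE.
- by move: (h8 _ _ _ _ hu hp hq hr); congr (_ \in S); apply/ffunP => i; rewrite !ffunE.
- by move: (h9 _ _ _ _ hu hv hp hq); congr (_ \in S); apply/ffunP => i; rewrite !ffunE.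
Qed.

(** The value tuples of term operations on the rows [h j] form a subuniverse that contains the
    tuples of the projections, and [f] preserves it. *)
Lemma term_op_interpolation (f : row -> elt N) k (h : 'I_k -> row) :
  (forall S : {set {ffun 'I_k -> elt N}},
     subuniverse (power (AM M) k) S -> preserves f S) ->
  exists2 p, term_op p & forall j, p (h j) = f (h j).
Proof.
move=> hf.
pose S := [set r : {ffun 'I_k -> elt N} |
            `[< exists2 p, term_op p & forall j, r j = p (h j) >]].
have inS (a : {ffun 'I_k -> elt N}) :
    a \in S <-> exists2 p, term_op p & forall j, a j = p (h j).
  by rewrite inE; split => /asboolP.
have SS : subuniverse (power (AM M) k) S.
  apply/subuniverseP; do ![split].
  - move=> x y /inS[p tp hx] /inS[q tq hy]; apply/inS.
    by eexists; [exact: term_meet tp tq|move=> j; rewrite ffunE hx hy].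
  - move=> x y /inS[p tp hx] /inS[q tq hy]; apply/inS.
    by eexists; [exact: term_M tp tq|move=> j; rewrite ffunE hx hy].
  - move=> x /inS[p tp hx]; apply/inS.
    by eexists; [exact: term_M' tp|move=> j; rewrite ffunE hx].
  - move=> x y /inS[p tp hx] /inS[q tq hy]; apply/inS.
    by eexists; [exact: term_I tp tq|move=> j; rewrite ffunE hx hy].
  - move=> x /inS[p tp hx]; apply/inS.
    by eexists; [exact: term_H tp|move=> j; rewrite ffunE hx].
  - move=> x y z /inS[p tp hx] /inS[q tq hy] /inS[r tr hz]; apply/inS.
    by eexists; [exact: term_N0 tp tq tr|move=> j; rewrite ffunE hx hy hz].
  - move=> x y z /inS[p tp hx] /inS[q tq hy] /inS[r tr hz]; apply/inS.
    by eexists; [exact: term_S tp tq tr|move=> j; rewrite ffunE hx hy hz].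
  - move=> u x y z /inS[v tv hu] /inS[p tp hx] /inS[q tq hy] /inS[r tr hz].
    apply/inS.
    by eexists; [exact: term_Ndot tv tp tq tr|move=> j; rewrite ffunE hu hx hy hz].
  - move=> u x y z /inS[v tv hu] /inS[p tp hx] /inS[q tq hy] /inS[r tr hz].
    apply/inS.
    by eexists; [exact: term_P tv tp tq tr|move=> j; rewrite ffunE hu hx hy hz].
have /inS[p tp hp] : coordinatewise f (fun t => [ffun j => h j t]) \in S.
  apply: hf => // t; apply/inS.
  by exists (fun s => s t); [exact: term_proj|move=> j; rewrite ffunE].
exists p => // j; rewrite -hp ffunE; congr f.
by apply/ffunP => t; rewrite !ffunE.
Qed.

Lemma term_op_State p : term_op p -> forall s s',
  (forall t, State (s t) = State (s' t)) -> State (p s) = State (p s').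
Proof.
move=> tp s s' ss'; elim: tp.
- by [].
- by move=> ? ? _ hp _ hq; rewrite !State_meet hp hq.
- by move=> ? ? _ hp _ hq; rewrite !State_M hp hq.
- by move=> ? _ hp; rewrite !State_M' hp.
- by move=> *; rewrite !State_I.
- by move=> *; rewrite !State_H.
- by move=> ? ? ? _ hp _ hq _ hr; rewrite !State_N0 hq hr.
- by move=> *; rewrite !State_S.
- by move=> ? ? ? ? _ hu _ hp _ hq _ hr; rewrite !State_Ndot hp hq hr.
- by move=> ? ? ? ? _ hu _ hp _ hq _ hr; rewrite !State_P hu hp hq hr.
Qed.

Lemma term_op_noD p : term_op p -> forall s,
  (forall t, ~~ inD (s t)) -> ~~ inD (p s).
Proof.
move=> tp s ss'; elim: tp => //=.
- by move=> {}p q _ hp _ hq; rewrite /AM_meet; case: ifP.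
- by move=> {}p q _ hp _ hq; apply: AM_M_inD.
- move=> {}p _ hp; rewrite /AM_M'.
  by case: (instr_at M _) => [[[[? R] j]|[[[? R] k] j]]|] //=; case: ifP.
- by move=> {}p q _ /negPf hp _ hq; rewrite /AM_I hp; case: ifP.
- by move=> {}p _ hp; rewrite /AM_H; case: ifP.
- by move=> {}p q r _ hp _ hq _ hr; rewrite /AM_N0; do ?case: ifP.
- by move=> {}p q r _ hp _ hq _ hr; rewrite /AM_S; do ?case: ifP.
- by move=> u {}p q r _ hu _ hp _ hq _ hr; rewrite /AM_Ndot; do ?case: ifP.
- by move=> u {}p q r _ hu _ hp _ hq _ hr; rewrite /AM_P; do ?case: ifP.
Qed.

End TermOperations.

(** * Content invariants of term operations on dot-free rows *)

Section Invariant.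
Variables (N : nat) (M : minsky N) (n : nat).
Local Notation row := {ffun 'I_n -> elt N}.
Implicit Types (p q : row -> elt N).

(* [Inv i a1 a2 c]: in state [i], the contents [a1], [a2] on the rows [s1], [s2]
   force the content [c] on [s]. *)
Variable Inv : state N -> content -> content -> content -> Prop.
Hypothesis Inv_isC : forall i a1 a2 c, Inv i a1 a2 c -> isC c.
Hypothesis Inv_fun : forall i a1 a2 c c',
  Inv i a1 a2 c -> Inv i a1 a2 c' -> c = c'.
Hypothesis Inv_zero : forall i, Inv i Zero Zero Zero.
Hypothesis Inv_next : forall i a1 a2 c,
  instr_at M i <> None -> Inv i a1 a2 c -> Inv (next_state M i) a1 a2 c.
Hypothesis Inv_zerotest : forall i i' R k j a1 a2 c,
  instr_at M i = Some (Dec i' R k j) -> Inv i a1 a2 c ->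
  a1 <> Reg R -> a2 <> Reg R -> c <> Reg R /\ Inv k a1 a2 c.

Variables s1 s2 s : row.
Hypothesis State1 : forall t, State (s1 t) = State (s t).
Hypothesis State2 : forall t, State (s2 t) = State (s t).
Hypothesis noD1 : forall t, ~~ inD (s1 t).
Hypothesis noD2 : forall t, ~~ inD (s2 t).
Hypothesis noD : forall t, ~~ inD (s t).
Hypothesis Inv_row : forall t, inC (s1 t) -> inC (s2 t) ->
  Inv (State (s t)) (Content (s1 t)) (Content (s2 t)) (Content (s t)).

Let holds p := inC (p s1) -> inC (p s2) ->
  Inv (State (p s)) (Content (p s1)) (Content (p s2)) (Content (p s)).

Let st1 p (tp : term_op M p) : State (p s1) = State (p s) :=
  term_op_State tp State1.
Let st2 p (tp : term_op M p) : State (p s2) = State (p s) :=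
  term_op_State tp State2.

(** Functionality of [Inv] carries an equality of arguments from [s1] and [s2] to [s], as required
    by the operations that test for equality. *)
Let holds_eq p q : term_op M p -> term_op M q -> holds p -> holds q ->
  inC (p s1) -> inC (p s2) -> p s1 = q s1 -> p s2 = q s2 -> p s = q s.
Proof.
move=> tp tq hp hq C1 C2 e1 e2.
have eS : State (p s) = State (q s).
  by rewrite -(st1 tp) e1 (st1 tq).
apply: elt_eq => //; apply: Inv_fun (hp C1 C2) _.
by rewrite eS e1 e2; apply: hq; rewrite -?e1 -?e2.
Qed.

Let holds_zero p : term_op M p -> holds p ->
  forall i, p s1 = (i, Zero) -> p s2 = (i, Zero) -> p s = (i, Zero).
Proof.
move=> tp hp i e1 e2; apply: elt_eq.
  by rewrite -(st1 tp) e1.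
have := hp; rewrite /holds e1 e2 => /(_ isT isT) /Inv_fun; apply.
exact: Inv_zero.
Qed.

(** On dot-free rows a content in C is either copied from an argument in C or is the Zero produced
    by [I], [H], [S]. Equality tests transfer by [holds_eq], zero tests by [Inv_zerotest], and the
    branch of [P] is decided by states, which agree on the three rows. *)
Lemma term_op_Inv p : term_op M p -> holds p.
Proof.
rewrite /holds; elim.
- exact: Inv_row.
- move=> {}p q tp hp tq hq C1 C2.
  have [e1 e2] := (inC_meet C1, inC_meet C2).
  move: C1 C2; rewrite -e1 -e2 !AM_meetxx => C1 C2.
  by rewrite -(holds_eq tp tq hp hq) // AM_meetxx; apply: hp.
- move=> {}p q tp hp tq hq C1 C2.
  have [e1 C1' i1 ->] := AM_M_noD (term_op_noD tp noD1) (term_op_noD tq noD1) C1.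
  have [e2 C2' _ ->] := AM_M_noD (term_op_noD tp noD2) (term_op_noD tq noD2) C2.
  have i0 : instr_at M (State (p s)) <> None.
    by rewrite -(st1 tp).
  rewrite -(holds_eq tp tq hp hq) // AM_Mxx ?(term_op_noD tp noD) //=.
  exact: Inv_next (hp C1' C2').
- move=> {}p tp hp C1 C2.
  have [C1' [i [R [k [j [iE n1 ->]]]]]] := AM_M'_inC C1.
  have [C2' [i2 [R2 [k2 [j2 [iE2 n2 ->]]]]]] := AM_M'_inC C2.
  move: iE iE2; rewrite (st1 tp) (st2 tp).
  move=> iE; rewrite iE => - [_ eR _ _]; rewrite -{}eR in n2.
  have [n0 I0] := Inv_zerotest iE (hp C1' C2') n1 n2.
  by rewrite (AM_M'E iE n0).
- move=> {}p q tp hp tq hq C1 C2.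
  have C1' := AM_I_inC (term_op_noD tp noD1) C1.
  have C2' := AM_I_inC (term_op_noD tp noD2) C2.
  rewrite !AM_IE ?(term_op_noD tp) //; exact: Inv_isC (hq C1' C2').
- move=> {}p tp hp C1 C2.
  have e1 := AM_H_inC (term_op_noD tp noD1) C1.
  have e2 := AM_H_inC (term_op_noD tp noD2) C2.
  by rewrite (holds_zero tp hp e1 e2) e1 e2 /AM_H eqxx.
- move=> {}p q r tp hp tq hq tr hr C1 C2.
  have [e1 S1 D1] := AM_N0_inC (term_op_noD tp noD1) C1.
  have [e2 _ D2] := AM_N0_inC (term_op_noD tp noD2) C2.
  have S2 : State (q s2) = State (r s2).
    by rewrite (st2 tq) (st2 tr) -(st1 tq) -(st1 tr).
  have S0 : State (q s) = State (r s).
    by rewrite -(st1 tq) -(st1 tr).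
  have I0 := hr D1 D2.
  by rewrite (holds_zero tp hp e1 e2) e1 e2 !AM_N0E //; exact: Inv_isC I0.
- move=> {}p q r tp hp tq hq tr hr C1 C2.
  have [e1 f1 g1] :=
    AM_S_inC (term_op_noD tq noD1) (term_op_noD tr noD1) C1.
  have [e2 f2 g2] :=
    AM_S_inC (term_op_noD tq noD2) (term_op_noD tr noD2) C2.
  rewrite (holds_zero tp hp e1 e2) (holds_zero tq hq f1 f2).
  rewrite (holds_zero tr hr g1 g2) e1 e2 f1 f2 g1 g2 /AM_S !eqxx.
  exact: Inv_zero.
- move=> u {}p q r tu hu tp hp tq hq tr hr C1 C2.
  have [e1 C1' S1] := AM_Ndot_inC (term_op_noD tu noD1) C1.
  have [e2 C2' S2] := AM_Ndot_inC (term_op_noD tu noD2) C2.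
  have e0 := holds_eq tp tq hp hq C1' C2' e1 e2.
  have I0 := hp C1' C2'.
  have S0 : State (q s) = State (r s) by rewrite -(st1 tq) -(st1 tr).
  have X0 : ~~ inX (p s) by case/andP: (Inv_isC I0).
  case/andP: C1' C2' => X1 _ /andP[X2 _].
  by rewrite -e1 -e2 -e0 !AM_NdotE // ?(e0, e1, e2).
- move=> u v {}p q tu hu tv hv tp hp tq hq.
  rewrite /AM_P !(st1 tu, st1 tv, st2 tu, st2 tv).
  by case: ifP.
Qed.

End Invariant.

(** * The dot-free case: rows on which [f] takes a value in C *)

Section DotFree.
Variables (N : nat) (M : minsky N) (n : nat).
Local Notation row := {ffun 'I_n -> elt N}.
Implicit Types (p q r : row -> elt N) (s : row).

Variable f : row -> elt N.
Hypothesis f_interp : forall s1 s2 s, exists2 p, term_op M p &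
  [/\ p s1 = f s1, p s2 = f s2 & p s = f s].

Variables (I : finType) (i0 l0 : I) (rho : I -> row).
Hypothesis l0i0 : l0 != i0.
Hypothesis rho_State : forall i j t, State (rho i t) = State (rho j t).
Hypothesis rho_noD : forall i t, ~~ inD (rho i t).
Hypothesis rho_C : forall p, term_op M p ->
  (forall i, i != i0 -> inC (p (rho i))) -> inC (p (rho i0)).
Hypothesis rho_zero : forall k, exists2 p, term_op M p &
  forall i, p (rho i) = (k, Zero).
Hypothesis f_rho : forall i, i != i0 -> inC (f (rho i)).

(** A meet lies in C only where its arguments agree, so [rho_C] for the meet of [p] and [q] forces
    agreement at [i0]. *)
Let term_det p q : term_op M p -> term_op M q ->
  (forall i, i != i0 -> p (rho i) = q (rho i)) ->
  (forall i, i != i0 -> inC (p (rho i))) -> p (rho i0) = q (rho i0).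
Proof.
move=> tp tq e C; apply: inC_meet.
by apply: (rho_C (term_meet tp tq)) => i ni; rewrite -e // AM_meetxx C.
Qed.

Let admissible s := forall t, State (s t) = State (rho i0 t) /\ ~~ inD (s t).

(** On the three rows involved [f] coincides with one term, to which [term_op_Inv] applies. *)
Let f_Inv Inv s1 s2 s :
  (forall i a1 a2 c, Inv i a1 a2 c -> isC c) ->
  (forall i a1 a2 c c', Inv i a1 a2 c -> Inv i a1 a2 c' -> c = c') ->
  (forall i, Inv i Zero Zero Zero) ->
  (forall i a1 a2 c, instr_at M i <> None -> Inv i a1 a2 c ->
     Inv (next_state M i) a1 a2 c) ->
  (forall i i' R k j a1 a2 c, instr_at M i = Some (Dec i' R k j) ->
     Inv i a1 a2 c -> a1 <> Reg R -> a2 <> Reg R ->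
     c <> Reg R /\ Inv k a1 a2 c) ->
  admissible s1 -> admissible s2 -> admissible s ->
  (forall t, inC (s1 t) -> inC (s2 t) ->
     Inv (State (s t)) (Content (s1 t)) (Content (s2 t)) (Content (s t))) ->
  inC (f s1) -> inC (f s2) -> inC (f s).
Proof.
move=> I1 I2 I3 I4 I5 a1 a2 a I0.
have [p tp [<- <- <-] C1 C2] := f_interp s1 s2 s.
suff /I1 : Inv (State (p s)) (Content (p s1)) (Content (p s2)) (Content (p s)) by [].
apply: (term_op_Inv I1 I2 I3 I4 I5) tp C1 C2 => // t;
  by case: (a1 t) (a2 t) (a t) => [e1 d1] [e2 d2] [e d]; rewrite ?e1 ?e2 ?e.
Qed.

(** The graph of [F] on contents in C is an invariant: since [F] creates no register content, a zero
    test passed by both arguments is passed by the result. *)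
Let f_binary F s1 s2 s :
  F Zero Zero = Zero ->
  (forall a b R, F a b = Reg R -> a = Reg R \/ b = Reg R) ->
  (forall a b, isC a -> isC b -> isC (F a b)) ->
  admissible s1 -> admissible s2 -> admissible s ->
  (forall t, inC (s1 t) -> inC (s2 t) ->
     Content (s t) = F (Content (s1 t)) (Content (s2 t))) ->
  inC (f s1) -> inC (f s2) -> inC (f s).
Proof.
move=> F0 FR FC a1 a2 a Fs.
apply: (f_Inv (Inv := fun _ a b c => [/\ isC a, isC b & c = F a b])) => //.
- by move=> _ ? ? ? [? ? ->]; apply: FC.
- by move=> _ ? ? ? ? [_ _ ->] [].
- by move=> _ ? R _ _ b1 b2 c _ [C1 C2 ->] n1 n2; do !split=> //; case/FR.
- by move=> t C1 C2; rewrite Fs.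
Qed.

(** Closure rules impose conditions only where their premises are in C; crosses outside [P] switch
    these conditions off. *)
Let mkrow (P : pred 'I_n) (phi : 'I_n -> content) : row :=
  [ffun t => (State (rho i0 t), if P t then phi t else Cross)].

Let admissible_mkrow (P : pred 'I_n) phi : (forall t, P t -> phi t != Dot) ->
  admissible (mkrow P phi).
Proof.
move=> h t; rewrite /mkrow ffunE; split=> //.
by rewrite /inD /=; case: ifP => // /h.
Qed.

Let mkrow_inC (P : pred 'I_n) phi t : inC (mkrow P phi t) ->
  P t /\ Content (mkrow P phi t) = phi t.
Proof. by rewrite /mkrow ffunE /inC /inX /inD /=; case: ifP. Qed.

(** Marks with [Reg R] the generators on which row [l] reads [Reg R] and each row in [ls] reads its
    entry of [x]. The list lets [f_binary] impose the conditions one row at a time. *)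
Let sigma R l (x : I -> content) (ls : seq I) : row :=
  mkrow (fun t => inC (rho l t) && all (fun j => inC (rho j t)) ls)
    (fun t => if (Content (rho l t) == Reg R)
                 && all (fun j => Content (rho j t) == x j) ls
              then Reg R else Zero).

Let admissible_sigma R l x ls : admissible (sigma R l x ls).
Proof. by apply: admissible_mkrow => t _; case: ifP. Qed.

Let f_sigma R l x ls : l != i0 -> all (fun j => j != i0) ls ->
  inC (f (sigma R l x ls)).
Proof.
move=> li0; elim: ls => [_|j ls IH /= /andP[ji0 /IH{}IH]].
  apply: (f_binary (F := fun a _ => if a == Reg R then Reg R else Zero))
    (f_rho li0) (f_rho li0) => //.
  - by move=> a b R'; case: eqP => // -> [->]; left.
  - by move=> a b; case: ifP.
  - by move=> t C _; rewrite /sigma /mkrow ffunE /= C !andbT.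
apply: (f_binary (F := fun a b => if (a == Reg R) && (b == x j) then Reg R else Zero))
  IH (f_rho ji0) => //.
- by move=> a b R'; case: ifP => // /andP[/eqP-> _] [->]; left.
- by move=> a b; case: ifP.
- move=> t /mkrow_inC[/andP[Cl Cls] ->] Cj; rewrite /sigma /mkrow ffunE /=.
  rewrite Cl Cj Cls /=.
  case: (Content (rho l t) == Reg R) => //=.
  by case: (Content (rho j t) == x j) => /=; case: all => //=; rewrite ?eqxx.
Qed.

Let inT t := [forall (i | i != i0), inC (rho i t)].
Let same t0 t :=
  [forall (i | i != i0), Content (rho i t) == Content (rho i t0)].

Let sigma_full R l x := sigma R l x (enum [pred i | i != i0]).

Let f_sigma_full R l x : l != i0 -> inC (f (sigma_full R l x)).
Proof.
by move=> li0; apply: f_sigma => //; apply/allP => j; rewrite mem_enum.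
Qed.

Let sigma_full_inC R l t0 t : l != i0 ->
  inC (sigma_full R l (fun i => Content (rho i t0)) t) -> inT t /\
  Content (sigma_full R l (fun i => Content (rho i t0)) t) =
    if (Content (rho l t) == Reg R) && same t0 t then Reg R else Zero.
Proof.
move=> li0 /mkrow_inC[/andP[Cl /allP Cls] ->]; split.
  by apply/forall_inP => i ni; apply: Cls; rewrite mem_enum.
congr (if _ && _ then _ else _); apply/allP/forall_inP => h i ni; apply: h;
  by move: ni; rewrite ?mem_enum.
Qed.

Let zrow := mkrow inT (fun=> Zero).
Let tau t0 := mkrow inT
  (fun t => if same t0 t then Content (rho i0 t) else Zero).

Let f_zrow : inC (f zrow).
Proof.
have h := f_sigma_full RegA (fun=> Zero) l0i0.
apply: (f_binary (F := fun _ _ => Zero)) (h) (h) => //.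
- exact: admissible_sigma.
- exact: admissible_sigma.
- exact: admissible_mkrow.
move=> t /mkrow_inC[/andP[Cl /allP Cls] _] _; rewrite /zrow /mkrow ffunE /=.
by case: ifP => // /negP[]; apply/forall_inP => i ni; apply: Cls; rewrite mem_enum.
Qed.

Let admissible_tau t0 : admissible (tau t0).
Proof. by apply: admissible_mkrow => t _; case: ifP => // _; exact: rho_noD. Qed.

Let tau_inT t0 t : inT t -> Content (tau t0 t) =
  if same t0 t then Content (rho i0 t) else Zero.
Proof. by move=> Tt; rewrite /tau /mkrow ffunE /= Tt. Qed.

(** The projection to [t] agrees off [i0] with the constant Zero term of the same state; [term_det]
    extends this to [i0]. *)
Let rho_zero_class t : (forall i, i != i0 -> Content (rho i t) = Zero) ->
  Content (rho i0 t) = Zero.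
Proof.
move=> z; have [p tp hp] := rho_zero (State (rho i0 t)).
suff -> : rho i0 t = p (rho i0) by rewrite hp.
have e i : i != i0 -> rho i t = p (rho i).
  by move=> ni; rewrite hp; apply: elt_eq; [exact: rho_State|exact: z].
apply: (term_det (term_proj M t) tp e) => i ni.
by rewrite e // hp.
Qed.

(** If no [x i] is a register content, [tau t0] is Zero wherever it is not crossed. Otherwise two
    [sigma_full] rows mark the class of [t0]: off the class everything is Zero, and on it terms
    reading [x] off [i0] determine the content at [i0]. *)
Let f_tau t0 : inT t0 -> inC (f (tau t0)).
Proof.
move=> Tt0; pose x i := Content (rho i t0).
have x_C i : i != i0 -> isC (x i) by move=> ni; exact: (forall_inP Tt0 i ni).
case: (pselect (exists i R, i != i0 /\ x i = Reg R)); last first.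
  move=> nR.
  have x0 i : i != i0 -> x i = Zero.
    move=> ni; have := x_C i ni; case E : (x i) => [|||R] //.
    by case: nR; exists i, R.
  apply: (f_binary (F := fun _ _ => Zero)) (f_zrow) (f_zrow) => //.
  - exact: admissible_mkrow.
  - exact: admissible_mkrow.
  move=> t /mkrow_inC[Tt _] _; rewrite tau_inT //; case: ifP => // /forall_inP st.
  by apply: rho_zero_class => i ni; rewrite (eqP (st i ni)); exact: x0.
case=> l1 [R1 [n1 x1]].
(* Only two registers exist; [R2] is [R1] when just one of them occurs in [x]. *)
have [l2 [R2 [n2 x2 xR]]] : exists l2 R2, [/\ l2 != i0, x l2 = Reg R2 &
    forall i R, i != i0 -> x i = Reg R -> R = R1 \/ R = R2].
  case: (pselect (exists i R, [/\ i != i0, x i = Reg R & R <> R1])).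
    case=> l2 [R2 [n2 x2 d]]; exists l2, R2; split=> // i R _ _.
    by case: R R1 R2 d {x1 x2} => [] [] [] //; by [left|right].
  move=> nR; exists l1, R1; split=> // i R ni xi.
  by case: (pselect (R = R1)) => [->|d]; [left|case: nR; exists i, R].
(* With both registers of [x] seen by the two [sigma] rows, a zero test that
   [Reg R1], [Reg R2] survive is survived by every [x i], [i <> i0]. *)
pose Inv i a1 a2 c := [/\ a1 = Zero, a2 = Zero & c = Zero] \/
  [/\ a1 = Reg R1, a2 = Reg R2 & exists r, [/\ term_op M r,
    forall l, l != i0 -> r (rho l) = (i, x l) & r (rho i0) = (i, c)]].
have rC i c r : term_op M r -> (forall l, l != i0 -> r (rho l) = (i, x l)) ->
    r (rho i0) = (i, c) -> isC c.
  move=> tr rl ri; suff : inC (r (rho i0)) by rewrite ri.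
  by apply: rho_C => // l nl; rewrite rl //; exact: x_C.
apply: (f_Inv (Inv := Inv)) (f_sigma_full R1 x n1) (f_sigma_full R2 x n2).
- by move=> i a1 a2 c [[_ _ ->]|[_ _ [r [tr rl ri]]]] //; exact: rC rl ri.
(* The first content, Zero or [Reg R1], decides the alternative; in the second one [term_det] makes
   the content at [i0] unique. *)
- move=> i a1 a2 c c' [[-> -> ->]|[-> -> [r [tr rl ri]]]].
    by case=> [[_ _ ->]|[]].
  case=> [[]|[_ _ [r' [tr' rl' ri']]]] //.
  suff : r (rho i0) = r' (rho i0) by rewrite ri ri' => -[].
  apply: term_det => // l nl; first by rewrite rl // rl'.
  by rewrite rl //; exact: x_C.
- by move=> i; left.
- move=> i a1 a2 c iE [|[-> -> [r [tr rl ri]]]]; [by left|right; split=> //].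
  have nD y : isC y -> AM_M M (i, y) (i, y) = (next_state M i, y).
    by move=> /andP[_ ny]; exact: AM_Mxx.
  exists (fun s => AM_M M (r s) (r s)); split; first exact: term_M.
    by move=> l nl; rewrite rl // nD // x_C.
  by rewrite ri nD //; exact: rC rl ri.
- move=> i i' R k j a1 a2 c iE [[-> -> ->] _ _|]; first by split=> //; left.
  move=> [-> -> [r [tr rl ri]]] d1 d2.
  have tl l : l != i0 -> AM_M' M (r (rho l)) = (k, x l).
    move=> nl; rewrite rl //; apply: (AM_M'E (x := (i, x l)) iE) => /= xl.
    by case: (xR l R nl xl) => E; [apply: d1|apply: d2]; rewrite E.
  (* The zero test keeps [r] in C off [i0], so [rho_C] keeps it in C at [i0]: hence [c] survives the
     test too. *)
  have /AM_M'_inC[_] : inC (AM_M' M (r (rho i0))).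
    apply: (rho_C (term_M' tr)) => l nl; rewrite tl //; exact: x_C.
  rewrite ri => -[i2 [R' [k' [j' [/=]]]]]; rewrite iE => -[_ <- <- _] nc e.
  split=> //; right; split=> //.
  by exists (fun s => AM_M' M (r s)); split=> //; [exact: term_M'|rewrite ri].
- exact: admissible_sigma.
- exact: admissible_sigma.
- exact: admissible_tau.
move=> t /(sigma_full_inC n1)[Tt ->] /(sigma_full_inC n2)[_ ->].
rewrite tau_inT //; case st : (same t0 t); last by rewrite !andbF; left.
have xt i : i != i0 -> Content (rho i t) = x i.
  by move=> ni; exact/eqP/(forall_inP st i ni).
rewrite (xt _ n1) (xt _ n2) x1 x2 !eqxx (admissible_tau t0 t).1 /=.
right; split=> //; exists (fun s => s t); split; first exact: term_proj.
  by move=> l nl; apply: elt_eq; [exact: rho_State|exact: xt].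
exact: elt_eq.
Qed.

Let omega (ts : seq 'I_n) := mkrow inT
  (fun t => if has (fun t0 => inT t0 && same t0 t) ts
            then Content (rho i0 t) else Zero).

(** Classes are glued one by one, keeping a nonzero content of [tau t0] and otherwise falling back
    on the previous row; overlapping classes agree, as both carry [rho i0]. *)
Let f_omega ts : inC (f (omega ts)).
Proof.
have adm us : admissible (omega us).
  by apply: admissible_mkrow => t _; case: ifP => // _; exact: rho_noD.
elim: ts => [|t0 ts IH]; first exact: f_zrow.
case Tt0: (inT t0); last first.
  suff -> : omega (t0 :: ts) = omega ts by [].
  by apply/ffunP => t; rewrite /omega /mkrow !ffunE /= Tt0.
apply: (f_binary (F := fun a b => if a == Zero then b else a)) (f_tau Tt0) IH => //.
- by move=> a b R; case: ifP => _ ->; [right|left].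
- by move=> a b; case: ifP.
move=> t /mkrow_inC[Tt ->] /mkrow_inC[_ ->].
rewrite /omega /mkrow ffunE /= Tt Tt0 /=.
by case: (same t0 t) => //=; case: eqP => // ->; case: ifP.
Qed.

(** With all generators listed, [omega] equals [rho i0] on [inT] and is crossed elsewhere, so the
    first projection as [F] leads from it to [rho i0]. *)
Lemma f_dot_free : inC (f (rho i0)).
Proof.
have h := f_omega (enum 'I_n).
apply: (f_binary (F := fun a _ => a)) (h) (h) => //.
- by move=> a b R ->; left.
- by apply: admissible_mkrow => t _; case: ifP => // _; exact: rho_noD.
- by apply: admissible_mkrow => t _; case: ifP => // _; exact: rho_noD.
move=> t /mkrow_inC[Tt ->] _; case: ifP => // /negP[].
apply/hasP; exists t; first by rewrite mem_enum.
by rewrite Tt; apply/forall_inP.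
Qed.

End DotFree.

(** Zero and Cross are kept by the diagonal case of [AM_M] and pass every zero test of [AM_M'], so
    any path of the state graph can be followed, whatever the registers. *)
Lemma reachable_term N (M : minsky N) n (p : {ffun 'I_n -> elt N} -> elt N) i j :
  reachable M i j -> term_op M p ->
  exists2 q, term_op M q & forall s : {ffun 'I_n -> elt N}, State (p s) = i ->
    Content (p s) = Zero \/ Content (p s) = Cross -> q s = (j, Content (p s)).
Proof.
move=> ij; elim: ij p => {i j} [i j edge|i|i k j _ IH1 _ IH2] p tp.
- have stay : exists2 q, term_op M q &
      forall s : {ffun 'I_n -> elt N}, State (p s) = i ->
      Content (p s) = Zero \/ Content (p s) = Cross -> q s = (i, Content (p s)).
    by exists p => // s e _; apply: elt_eq.
  have move_next : instr_at M i <> None -> exists2 q, term_op M q &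
      forall s : {ffun 'I_n -> elt N}, State (p s) = i ->
      Content (p s) = Zero \/ Content (p s) = Cross ->
      q s = (next_state M i, Content (p s)).
    move=> iE; exists (fun s => AM_M M (p s) (p s)); first exact: term_M.
    move=> s e h; rewrite AM_Mxx ?e //.
    by rewrite /inD; case: h => ->.
  case: edge => a [b [a' [b' /=]]]; case: ifP => [_ [<- _ _] //|_].
  have move_zero i' R k j' : instr_at M i = Some (Dec i' R k j') ->
      exists2 q, term_op M q & forall s : {ffun 'I_n -> elt N}, State (p s) = i ->
      Content (p s) = Zero \/ Content (p s) = Cross -> q s = (k, Content (p s)).
    move=> iE; exists (fun s => AM_M' M (p s)); first exact: term_M'.
    move=> s e h; rewrite -e in iE; apply: AM_M'E iE _.
    by case: h => ->.
  move: move_next move_zero; rewrite /next_state.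
  case: (instr_at M i) => [[[[? []] j']|[[[i' []] k] j']]|] mn mz;
    do ?case: ifP => _; case=> <- _ _ //; by [exact: mn|exact: mz].
- by exists p => // s e _; apply: elt_eq.
have [q tq hq] := IH1 p tp; have [r tr hr] := IH2 q tq.
by exists r => // s e h; have := hr s; rewrite (hq s e h) => ->.
Qed.

(** * Realising a crossed tuple by a term operation *)

Section Crossed.
Variables (N : nat) (M : minsky N) (n : nat).
Local Notation row := {ffun 'I_n -> elt N}.
Implicit Types (p q r u : row -> elt N) (s : row).

Hypothesis from_init : forall i, reachable M init_st i.
Hypothesis genM : (halt_st, Dot)
  \in Sg (AM M) [set (init_st, Dot); (init_st, Zero)].

Variables (I : finType) (rho : I -> row).
Hypothesis avoid2 : forall i j : I, exists k, k != i /\ k != j.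
Hypothesis sync : forall p, term_op M p ->
  forall i j, State (p (rho i)) = State (p (rho j)).
Hypothesis oneD : forall p, term_op M p ->
  forall i j, inD (p (rho i)) -> inD (p (rho j)) -> i = j.
Hypothesis nonhalting : forall p, term_op M p ->
  (forall i, p (rho i) = (halt_st, Zero) \/ p (rho i) = (halt_st, Dot)) ->
  forall i, p (rho i) = (halt_st, Zero).

Section Simulation.
Variables (i0 : I) (u b : row -> elt N).
Hypotheses (tu : term_op M u) (tb : term_op M b).
Hypothesis uD : inD (u (rho i0)).
Hypothesis bC : forall i, inC (b (rho i)).

(* With <1,Dot> available at [i0] only and <1,Zero> everywhere, the machine can
   be simulated at [i0] while all other coordinates keep content Zero. *)
Lemma no_dot_over_C : False.
Proof.
have u_noD i : i != i0 -> ~~ inD (u (rho i)).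
  by move=> ni; apply: contra ni => di; rewrite (oneD tu di uD).
have noD i : ~~ inD (b (rho i)) by case/andP: (bC i).
pose lifts a p := p (rho i0) = a /\
  forall i, i != i0 -> p (rho i) = (State a, Zero).
(* All crossed elements are put in [G], so closure is at stake only for results that are not
   crossed. *)
pose G := [set a : elt N |
  `[< inX a \/ exists2 p, term_op M p & lifts a p >]].
have inG a : a \in G <-> inX a \/ exists2 p, term_op M p & lifts a p.
  by rewrite inE; split => /asboolP.
have GX i : (i, Cross) \in G by apply/inG; left.
have GnX a : a \in G -> ~~ inX a -> exists2 p, term_op M p & lifts a p.
  by move=> /inG[->|].
have G0 : (init_st, Zero) \in G.
  apply/inG; right; exists (fun s => AM_I (b s) (b s)); first exact: term_I.
  by split=> [|i _]; rewrite AM_IE.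
have G1 : (init_st, Dot) \in G.
  apply/inG; right; exists (fun s => AM_I (u s) (b s)); first exact: term_I.
  by split=> [|i ni]; [rewrite /AM_I uD|rewrite AM_IE // u_noD].
(* A lift of <0,Dot> would be a halting tuple: Dot at [i0] and Zero elsewhere, in state 0. *)
have haltG : (halt_st, Dot) \notin G.
  apply/negP => /GnX /(_ isT)[p tp [p0 pi]].
  suff : p (rho i0) = (halt_st, Zero) by rewrite p0.
  apply: nonhalting => // i.
  by have [->|/pi->] := eqVneq i i0; [right|left].
suff /(Sg_min (x := (halt_st, Dot))) : subuniverse (AM M) G.
  move=> /(_ [set (init_st, Dot); (init_st, Zero)]) h.
  move/negP: haltG; apply; apply: h => //.
  by apply/subsetP => a; rewrite in_set2 => /orP[] /eqP->.
apply/subuniverseP; do ![split] => /=.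
- by move=> x y Gx Gy; rewrite /AM_meet; case: ifP.
- move=> x y Gx Gy; case X: (inX (AM_M M x y)); first by apply/inG; left.
  have [Xx Xy e iE] := AM_M_nX (negbT X).
  have [p tp [p0 pi]] := GnX x Gx Xx; have [q tq [q0 qi]] := GnX y Gy Xy.
  apply/inG; right; exists (fun s => AM_M M (p s) (q s)); first exact: term_M.
  split=> [|i ni]; first by rewrite p0 q0.
  (* Off [i0] both arguments are Zero in the same state, and the diagonal case keeps Zero. *)
  by rewrite pi // qi // -e AM_Mxx // State_M e eqxx.
- move=> x Gx; case X: (inX (AM_M' M x)); first by apply/inG; left.
  have [Xx [i [R [k [j [iE kE]]]]]] := AM_M'_nX (negbT X).
  have [p tp [p0 pi]] := GnX x Gx Xx.
  apply/inG; right; exists (fun s => AM_M' M (p s)); first exact: term_M'.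
  split=> [|l nl]; first by rewrite p0.
  by rewrite pi // (AM_M'E (x := (State x, Zero)) iE) // kE.
- by move=> x y Gx Gy; rewrite /AM_I; do ?case: ifP.
- move=> x Gx; rewrite /AM_H; case: ifP => // /orP xE.
  have [|p tp [p0 pi]] := GnX x Gx; first by case: xE => /eqP->.
  apply/inG; right; exists (fun s => AM_H (p s)); first exact: term_H.
  split=> [|i ni]; first by rewrite p0 /AM_H; case: xE => ->; rewrite ?orbT.
  by rewrite pi //; case: xE => /eqP->; rewrite AM_H_zero.
- move=> x y z Gx Gy Gz; rewrite /AM_N0.
  (* [haltG] excludes the first case of [AM_N0]; the others return [z] or a cross. *)
  case: (x =P (halt_st, Dot)) => [xE|_ /=]; first by rewrite -xE Gx in haltG.
  by rewrite /crossed; case: ifP.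
- by move=> x y z Gx Gy Gz; rewrite /AM_S; case: ifP.
- by move=> w x y z Gw Gx Gy Gz; rewrite /AM_Ndot /crossed; do ?case: ifP.
- by move=> w v x y Gw Gv Gx Gy; rewrite /AM_P; case: ifP.
Qed.

End Simulation.

Variable f : row -> elt N.
Hypothesis f_interp : forall s1 s2 s, exists2 p, term_op M p &
  [/\ p s1 = f s1, p s2 = f s2 & p s = f s].
Hypothesis f_off : forall i, exists2 p, term_op M p &
  forall j, j != i -> p (rho j) = f (rho j).

Lemma crossed_term (i0 : I) : inX (f (rho i0)) ->
  exists2 p, term_op M p & forall i, p (rho i) = f (rho i).
Proof.
move=> X0.
have avoid1 (i : I) : exists k, k != i by have [k [nk _]] := avoid2 i i; exists k.
set st := State (f (rho i0)).
have fst i : State (f (rho i)) = st.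
  (* A term correct off a third index [k] is correct at both [i] and [i0], and terms are
     synchronized. *)
  have [k [nki nk0]] := avoid2 i i0; have [p tp hp] := f_off k.
  rewrite /st -!hp; [exact: sync|by rewrite eq_sym..].
have off_st i p : term_op M p -> (forall j, j != i -> p (rho j) = f (rho j)) ->
    forall j, State (p (rho j)) = st.
  move=> tp hp j; have [k nk] := avoid1 i.
  by rewrite (sync tp j k) hp.
have fX i : inX (f (rho i)) -> f (rho i) = (st, Cross).
  by move=> /eqP Xi; apply: elt_eq; rewrite ?fst.
have [b tb hb] := f_off i0; have bst := off_st _ _ tb hb.
case Xb : (inX (b (rho i0))).
  exists b => // i; have [->|/hb //] := eqVneq i i0.
  by rewrite fX //; apply: elt_eq => //; exact/eqP.
have b0X := negbT Xb.
(* With a second cross at [j], [p] is crossed at [i0], [b] at [j], and elsewhere both equal [f]. *)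
case: (pselect (exists2 j, j != i0 & inX (f (rho j)))) => [[j nj Xj]|nXX].
  have [p tp hp] := f_off j; have pst := off_st _ _ tp hp.
  exists (fun s => AM_meet (p s) (b s)); first exact: term_meet.
  move=> i; have [->|ni] := eqVneq i i0.
    by rewrite (fX _ X0) (meet_cross (i := st)) // hp 1?eq_sym // X0.
  have [->|nij] := eqVneq i j.
    by rewrite (fX _ Xj) (meet_cross (i := st)) // hb // Xj orbT.
  by rewrite hp // hb // AM_meetxx.
have fnX i : i != i0 -> ~~ inX (f (rho i)).
  by move=> ni; apply/negP => Xi; apply: nXX; exists i.
case: (pselect (exists u i, [/\ term_op M u, i != i0 & inD (u (rho i))])).
  move=> [u [i [tu ni Di]]].
  have [p tp hp] := f_off i; have pst := off_st _ _ tp hp.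
  (* At [i] the dot of [u] selects [b]; at [i0] there is no dot and [p] is crossed; elsewhere [p]
     and [b] agree. *)
  exists (fun s => AM_Ndot (u s) (p s) (b s) (b s)); first exact: term_Ndot.
  move=> j; have [->|nj] := eqVneq j i0.
    rewrite (fX _ X0); apply: AM_Ndot_cross => //.
      by apply: contra ni => D0; rewrite (oneD tu Di D0).
    by rewrite hp 1?eq_sym.
  have [->|nij] := eqVneq j i.
    by rewrite -hb //; apply: AM_Ndot_select; rewrite ?pst ?bst // hb ?fnX.
  by rewrite hp // -hb // AM_NdotE // hb // fnX.
move=> nD'.
have noD u i : term_op M u -> i != i0 -> ~~ inD (u (rho i)).
  by move=> tu ni; apply/negP => Di; apply: nD'; exists u, i.
have bC i : i != i0 -> inC (b (rho i)).
  by move=> ni; rewrite /inC noD // hb // fnX.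
(* Moved to state 0, [v] is a gate for [AM_N0], open off [i0] and crossing [b] at [i0]. *)
have key v : term_op M v -> (forall i, i != i0 -> v (rho i) = (init_st, Zero)) ->
    v (rho i0) = (init_st, Cross) ->
    exists2 p, term_op M p & forall i, p (rho i) = f (rho i).
  move=> tv vi v0; have [h th hh] := reachable_term (from_init halt_st) tv.
  exists (fun s => AM_N0 (h s) (b s) (b s)); first exact: term_N0.
  move=> i; have [->|ni] := eqVneq i i0.
    rewrite hh v0 //=; last by right.
    by rewrite AM_N0_cross (fX _ X0) /crossed bst.
  rewrite hh vi //=; last by left.
  by rewrite AM_N0E ?hb // -hb // bC.
case D0 : (inD (b (rho i0))).
  (* [p] is correct at [i0], hence crossed there, so [AM_I] meets no dot in first place and, [b]
     being a dot, nothing of C in second place. *)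
  have [j nj] := avoid1 i0; have [p tp hp] := f_off j.
  have p0 : ~~ inD (p (rho i0)).
    by rewrite hp 1?eq_sym // (fX _ X0).
  apply: (key (fun s => AM_I (p s) (b s))); first exact: term_I.
    by move=> i ni; rewrite AM_IE ?noD ?bC.
  by rewrite AM_I_cross // /inC D0 andbF.
have bC' i : inC (b (rho i)).
  have [->|] := eqVneq i i0; last exact: bC.
  by rewrite /inC b0X D0.
case: (pselect (exists2 u, term_op M u & inD (u (rho i0)))) => [[u tu uD]|nD0].
  by case: (no_dot_over_C tu tb uD bC').
have noD' u i : term_op M u -> ~~ inD (u (rho i)).
  move=> tu; have [->|] := eqVneq i i0; last exact: noD.
  by apply/negP => Du; apply: nD0; exists u.
case: (pselect (exists2 q, term_op M q &
    (forall i, i != i0 -> inC (q (rho i))) /\ ~~ inC (q (rho i0)))).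
  move=> [q tq [qC q0]].
  apply: (key (fun s => AM_I (q s) (q s))); first exact: term_I.
    by move=> i ni; rewrite AM_IE ?noD' ?qC.
  by rewrite AM_I_cross ?noD'.
move=> nq; have [l0 nl0] := avoid1 i0.
suff : inC (f (rho i0)) by rewrite /inC X0.
apply: (f_dot_free f_interp nl0).
- by move=> i j t; exact: (sync (term_proj M t)).
- by move=> i t; exact: (noD' _ i (term_proj M t)).
- move=> p tp pC; case C0 : (inC (p (rho i0))) => //.
  by case: nq; exists p => //; rewrite C0.
(* [AM_I] of [b] with itself is <1,Zero> on every row; a path from state 1 carries it to [k]. *)
- move=> k; have [q tq hq] := reachable_term (from_init k) (term_I tb tb).
  have zE i : AM_I (b (rho i)) (b (rho i)) = (init_st, Zero).
    by rewrite AM_IE ?noD'.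
  by exists q => // i; rewrite hq zE //; left.
- by move=> i ni; rewrite -hb.
Qed.

End Crossed.

(** * Passage from tuples in [R] to rows of the generators *)

Theorem theorem8p11 (N : nat) (M : minsky N) (kappa : nat)
    (wfM : wf_machine M kappa)
    (genM : (halt_st, Dot)
              \in Sg (AM M) [set (init_st, Dot); (init_st, Zero)])
    (m n : nat) (hm : 11 <= m)
    (f : {ffun 'I_n -> elt N} -> elt N)
    (hf : forall (k : nat) (S : {set {ffun 'I_k -> elt N}}),
        k <= m - 1 -> subuniverse (power (AM M) k) S -> preserves f S)
    (g : 'I_n -> {ffun 'I_m -> elt N})
    (R : {set {ffun 'I_m -> elt N}})
    (hR : R = Sg (power (AM M) m) [set g t | t : 'I_n])
    (Rcomp : computational R) (Rnonhalt : ~ halting R)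
    (alpha : {ffun 'I_m -> elt N}) (hfg : coordinatewise f g = alpha)
    (halpha : exists i : 'I_m, inX (alpha i)) :
  alpha \in R.
Proof.
(* From here the tuples have [m.+1] coordinates and [f] preserves the relations of arity at most
   [m]. *)
case: m hm hf g R hR Rcomp Rnonhalt alpha hfg halpha => // m hm hf g R hR.
move=> Rcomp Rnonhalt alpha hfg [i0 X0]; rewrite subSS subn0 in hf.
pose rho (i : 'I_m.+1) : {ffun 'I_n -> elt N} := [ffun t => g t i].
have evalE p i : coordinatewise p g i = p (rho i) by rewrite ffunE.
have evalR p : term_op M p -> coordinatewise p g \in R.
  move=> tp; rewrite hR; apply: term_op_subuniverse tp.
    exact: Sg_subuniverse.
  by move=> t; apply: mem_Sg; apply: imset_f.
have interp k (h : 'I_k -> {ffun 'I_n -> elt N}) : k <= m ->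
    exists2 p, term_op M p & forall j, p (h j) = f (h j).
  by move=> km; apply: term_op_interpolation => S; exact: hf.
have [||||||||p tp hp] := @crossed_term N M n _ genM _ rho _ _ _ _ f _ _ i0.
- exact: wf_from_init wfM.
- move=> i j.
  have : 0 < #|~: [set i; j]|.
    rewrite cardsCs setCK card_ord subn_gt0.
    by apply: leq_ltn_trans (_ : 2 < _); [rewrite cards2; case: eqP|exact: leq_trans hm].
  by case/card_gt0P => k; rewrite in_setC in_set2 negb_or => /andP[]; exists k.
- by move=> p tp i j; have := (Rcomp _ (evalR p tp)).1 i j; rewrite !evalE.
- by move=> p tp i j; have := (Rcomp _ (evalR p tp)).2 i j; rewrite !evalE.
- move=> p tp h; apply: contrapT => nz; apply: Rnonhalt.
  exists (coordinatewise p g); first exact: evalR.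
  split=> [i|z]; first by rewrite evalE.
  by apply: nz => i; rewrite -evalE.
(* The default value of [nth] supplies the third row. *)
- move=> s1 s2 s; pose h (j : 'I_3) := nth s [:: s1; s2] j.
  have [p tp hp] := interp 3 h (leq_trans (isT : 3 <= 10) hm).
  exists p => //; split; first exact: hp ord0.
    exact: (hp (@Ordinal 3 1 isT)).
  exact: (hp (@Ordinal 3 2 isT)).
(* [lift i] enumerates the [m] coordinates other than [i]. *)
- move=> i; have [p tp hp] := interp m (fun j => rho (lift i j)) (leqnn m).
  by exists p => // j; case: (unliftP i j) => [k ->|->]; rewrite ?hp ?eqxx.
- by rewrite -evalE hfg.
rewrite -hfg (_ : coordinatewise f g = coordinatewise p g); first exact: evalR.
by apply/ffunP => i; rewrite !evalE hp.
Qed.
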